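(* Let $H$ be a $k$-uniform hypergraph without isolated vertices, with vertex-edge incidence matrix $B$. Then $$m(H)\le k\,e^\top(B^\top B)^\#e,$$ with equality if and only if $H$ has a perfect matching. If $H$ has a perfect matching, then $$m(H)=\Theta(\Omega(H))=\vartheta(\Omega(H))=k\,e^\top(B^\top B)^\#e.$$
   Context: A hypergraph is $k$-uniform if each edge has exactly $k$ vertices. $m(H)$ is the matching number (maximum number of pairwise disjoint edges). The vertex-edge incidence matrix $B$ is the $|V(H)|\times|E(H)|$ 0/1 matrix with $(B)_{uf}=1$ iff $u\in f$. $e$ is the all-ones vector (of length $|E(H)|$). $(B^\top B)^\#$ is the group inverse (unique $X$ with $NXN=N$, $XNX=X$, $NX=XN$ for $N=B^\top B$). The intersection graph $\Omega(H)$ has vertex set $E(H)$, two edges adjacent iff they intersect. $\Theta$ is the Shannon capacity $\Theta(G)=\lim_k\alpha(G^k)^{1/k}$ with $G^k$ the strong power (vertex set $V^k$, distinct tuples adjacent iff in each coordinate they are equal or adjacent), and $\vartheta$ is the Lovász theta function (minimum largest eigenvalue of a real symmetric matrix indexed by the vertices with entry $1$ whenever $i=j$ or $i,j$ nonadjacent). *)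

(* Defs.v *)
From HB Require Import structures.
From mathcomp Require Import all_boot all_order all_algebra.
From mathcomp Require Import all_classical all_reals all_analysis.

Set Implicit Arguments.
Unset Strict Implicit.
Unset Printing Implicit Defensive.

Import Order.TTheory GRing.Theory Num.Theory.
Import numFieldNormedType.Exports.

Local Open Scope classical_set_scope.
Local Open Scope ring_scope.

(* A simple graph is a symmetric irreflexive relation on a finType. *)
Section Graphs.
Variables (T : finType) (adj : rel T).

Definition independent (S : {set T}) : bool :=
  [forall x in S, forall y in S, ~~ adj x y].

Definition independence_number : nat :=
  (\max_(S : {set T} | independent S) #|S|)%N.

Definition strong_power (n : nat) : rel {ffun 'I_n -> T} :=
  fun x y => (x != y) && [forall i, (x i == y i) || adj (x i) (y i)].

End Graphs.

Definition shannon_capacity (R : realType) (T : finType) (adj : rel T) : R :=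
  lim ((fun n : nat =>
    (independence_number (strong_power adj (n := n)))%:R `^ (n%:R^-1) : R)
      @ \oo).

Section Theta.
Variable R : realType.

Definition largest_eigenvalue n (A : 'M[R]_n) (t : R) : Prop :=
  eigenvalue A t /\ forall s, eigenvalue A s -> s <= t.

(* Row and column i of A correspond to the vertex enum_val i. *)
Definition theta_matrix (T : finType) (adj : rel T) (A : 'M[R]_#|T|) : Prop :=
  A^T = A /\
  forall i j, (i == j) || ~~ adj (enum_val i) (enum_val j) -> A i j = 1.

(* The least element of S, or 0 if there is none. *)
Definition minimum (S : set R) : R := xget 0 (S `&` lbound S).

Definition lovasz_theta (T : finType) (adj : rel T) : R :=
  minimum [set t | exists A : 'M[R]_#|T|,
                     theta_matrix adj A /\ largest_eigenvalue A t].

Definition is_group_inverse n (N X : 'M[R]_n) : Prop :=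
  [/\ N *m X *m N = N, X *m N *m X = X & N *m X = X *m N].

(* A group inverse is unique when it exists; otherwise the value is 0. It
   exists for every real symmetric N. *)
Definition group_inverse n (N : 'M[R]_n) : 'M[R]_n :=
  xget 0 [set X | is_group_inverse N X].

End Theta.

(* A hypergraph with vertex set V is given by its set E of edges. *)
Section Hypergraphs.
Variables (V : finType) (E : {set {set V}}).

Definition k_uniform (k : nat) : Prop := forall f, f \in E -> #|f| = k.

Definition no_isolated_vertex : Prop :=
  forall v : V, exists2 f, f \in E & v \in f.

Definition matching (M : {set {set V}}) : bool := (M \subset E) && finset.trivIset M.

Definition matching_number : nat :=
  (\max_(M : {set {set V}} | matching M) #|M|)%N.

Definition has_perfect_matching : Prop :=
  exists2 M, matching M & finset.cover M = [set: V]%SET.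

Definition edge : finType := {f : {set V} | f \in E}.

Definition intersection_graph : rel edge :=
  fun f g => (f != g) && (val f :&: val g != finset.set0)%SET.

Definition incidence_matrix (R : realType) : 'M[R]_(#|V|, #|edge|) :=
  \matrix_(u, f) ((enum_val u : V) \in val (enum_val f : edge))%:R.

Definition group_inverse_sum (R : realType) : R :=
  let B := incidence_matrix R in
  let e : 'cV[R]_#|edge| := const_mx 1 in
  (e^T *m group_inverse (B^T *m B) *m e) 0 0.

End Hypergraphs.

Arguments intersection_graph {V} E f g.

(* Main.v *)
(** Write [N = B^T B] and let [y = N^# e]. Since [e = B^T 1 / k] lies in the row
    space of [B], [N y = e], so [p = k B y] is the orthogonal projection of the
    all-ones vector onto the column space of [B]. The indicator [w] of the
    vertices covered by a matching [M] lies in that space, and expanding gives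
    [|p - w|^2 = k (k e^T N^# e - |M|)]. This proves the bound; in case of
    equality [B^T w = B^T p = k e], so every edge lies in the cover of [M].

    An independent set of the n-th strong power of the intersection graph is a
    family of pairwise disjoint boxes [f_1 x ... x f_n] of [k^n] points in
    [V^n]; when a perfect matching [M] exists there are thus at most [|M|^n] of
    them, and [M^n] attains this. For the theta function, the matrix
    [J + |M| I - (|M| / k) N] has largest eigenvalue [|M|] by Cauchy-Schwarz,
    and evaluating the Rayleigh quotient of any feasible matrix at the indicator
    of [M] gives the matching lower bound. *)

Require Import Defs.
From HB Require Import structures.
From mathcomp Require Import all_boot all_order all_algebra.
From mathcomp Require Import all_classical all_reals all_analysis.
From mathcomp Require Import ring.
From mathcomp Require complex.

Set Implicit Arguments.
Unset Strict Implicit.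
Unset Printing Implicit Defensive.

Import numFieldNormedType.Exports.
Import Order.TTheory GRing.Theory Num.Theory.
Local Open Scope ring_scope.

(** * Group inverses of symmetric matrices, inner products and Rayleigh quotients *)

Section Gram.
Variable R : realType.

Lemma mulmx_trmx_eq0 (m n : nat) (D : 'M[R]_(m, n)) : D *m D^T = 0 -> D = 0.
Proof.
move=> D0; apply/matrixP => i j; rewrite mxE.
have /matrixP/(_ i i) := D0; rewrite !mxE => /eqP.
rewrite psumr_eq0 => [/allP/(_ j (mem_index_enum j))|l _]; rewrite mxE.
  by rewrite mulf_eq0 orbb => /eqP.
by rewrite -expr2 sqr_ge0.
Qed.

(** If [K N N = 0], then [(K N) (K N)^T = 0], so [K N = 0]. Thus [N] and [N *m N] have equal kernels
    and ranks, and the evident inclusion of row spaces is an equality. *)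
Lemma symmetric_sub_sqr n (N : 'M[R]_n) : N^T = N -> (N <= N *m N)%MS.
Proof.
move=> NT.
have kerNN : (kermx (N *m N) <= kermx N)%MS.
  apply/sub_kermxP/mulmx_trmx_eq0.
  rewrite trmx_mul NT !mulmxA -(mulmxA (kermx _)).
  by have /sub_kermxP -> := submx_refl (kermx (N *m N)); rewrite mul0mx.
have := mxrankS kerNN; rewrite !mxrank_ker leq_sub2lE ?rank_leq_row // => rkN.
rewrite -(mxrank_leqif_sup (submxMl N N)).
by rewrite eqn_leq rkN mxrankS ?submxMl.
Qed.

(** Transposing [N = b N^2] gives [N = N^2 a]. Then [P = N a = b N] is an idempotent acting as the
    identity on [N] from both sides, and [P a] is the group inverse. *)
Lemma group_inverse_exists n (N : 'M[R]_n) :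
  N^T = N -> exists X, is_group_inverse N X.
Proof.
move=> NT; have /submxP[b Nb] := symmetric_sub_sqr NT.
pose a := b^T; have Na : N = N *m N *m a.
  by rewrite -[LHS]NT [in LHS]Nb !trmx_mul NT.
pose P := N *m a; have Pb : P = b *m N.
  by rewrite /P {1}Nb -!mulmxA (mulmxA N N a) -Na.
have NP : N *m P = N by rewrite mulmxA -Na.
have PN : P *m N = N by rewrite Pb -mulmxA -Nb.
have NX : N *m (P *m a) = P by rewrite mulmxA NP.
have XN : P *m a *m N = P.
  by rewrite {1}Pb -(mulmxA b) -/P -mulmxA PN -Pb.
have PP : P *m P = P by rewrite {1}Pb -mulmxA NP -Pb.
exists (P *m a); split; rewrite ?XN ?NX //.
by rewrite mulmxA PP.
Qed.

Lemma group_inverseP n (N : 'M[R]_n) :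
  N^T = N -> is_group_inverse N (group_inverse N).
Proof. by move=> /group_inverse_exists; exact: xgetPex. Qed.

(** With [X] the group inverse, [D = (N X - 1) B^T] satisfies
    [D D^T = (N X N - N) (N X - 1)^T = 0]. *)
Lemma gram_group_inverseK m n (B : 'M[R]_(m, n)) (N := B^T *m B) :
  N *m group_inverse N *m B^T = B^T.
Proof.
have NT : N^T = N by rewrite trmx_mul trmxK.
have [NXN _ _] := group_inverseP NT.
set X := group_inverse N in NXN *.
apply/eqP; rewrite -subr_eq0; apply/eqP/mulmx_trmx_eq0.
rewrite -[X in _ - X]mul1mx -mulmxBl trmx_mul trmxK mulmxA.
by rewrite -(mulmxA _ _ B) -/N mulmxBl NXN mul1mx subrr mul0mx.
Qed.

Definition dot n (a b : 'cV[R]_n) : R := (a^T *m b) 0 0.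

Lemma dotE n (a b : 'cV[R]_n) : dot a b = \sum_i a i 0 * b i 0.
Proof. by rewrite /dot mxE; apply: eq_bigr => i _; rewrite mxE. Qed.

Lemma dotC n (a b : 'cV[R]_n) : dot a b = dot b a.
Proof. by rewrite !dotE; apply: eq_bigr => i _; rewrite mulrC. Qed.

Lemma dotDr n (a b c : 'cV[R]_n) : dot a (b + c) = dot a b + dot a c.
Proof. by rewrite /dot mulmxDr mxE. Qed.

Lemma dotBr n (a b c : 'cV[R]_n) : dot a (b - c) = dot a b - dot a c.
Proof. by rewrite /dot mulmxBr !mxE. Qed.

Lemma dotZl n c (a b : 'cV[R]_n) : dot (c *: a) b = c * dot a b.
Proof. by rewrite /dot linearZ -scalemxAl mxE. Qed.

Lemma dotZr n c (a b : 'cV[R]_n) : dot a (c *: b) = c * dot a b.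
Proof. by rewrite dotC dotZl dotC. Qed.

Lemma dot_mulmx m n (B : 'M[R]_(m, n)) a b : dot (B *m a) b = dot a (B^T *m b).
Proof. by rewrite /dot trmx_mul mulmxA. Qed.

Lemma const_mx1_mul n (a : 'cV[R]_n) :
  const_mx 1 *m a = dot (const_mx 1) a *: const_mx 1 :> 'cV[R]_n.
Proof.
apply/colP => i; rewrite dotE !mxE mulr1.
by apply: eq_bigr => j _; rewrite !mxE.
Qed.

Lemma dot_ge0 n (a : 'cV[R]_n) : 0 <= dot a a.
Proof. by rewrite dotE sumr_ge0 // => i _; rewrite -expr2 sqr_ge0. Qed.

Lemma dot_eq0 n (a : 'cV[R]_n) : dot a a = 0 -> a = 0.
Proof.
rewrite /dot => aa; apply: trmx_inj; rewrite trmx0; apply: mulmx_trmx_eq0.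
by rewrite trmxK; apply/matrixP => i j; rewrite !ord1 aa mxE.
Qed.

Lemma dotBB n (a b : 'cV[R]_n) :
  dot (a - b) (a - b) = dot a a - 2 * dot a b + dot b b.
Proof. by rewrite dotBr (dotC _ a) (dotC _ b) !dotBr (dotC b a); ring. Qed.

Import complex.
Local Open Scope sesquilinear_scope.

(* [spectral.v] diagonalizes over an algebraically closed field, hence the
   passage to [R[i]]. *)
Lemma rayleigh_le n (A : 'M[R]_n) (t : R) (x : 'rV[R]_n) :
  A^T = A -> (forall s, eigenvalue A s -> s <= t) ->
  (x *m A *m x^T) 0 0 <= t * (x *m x^T) 0 0.
Proof.
move=> AT At; pose toC := real_complex R.
have conjE (r : R) : (toC r)^* = toC r by apply/CrealP; rewrite complex_real.
have trC m p (M : 'M[R]_(m, p)) : (map_mx toC M)^t* = map_mx toC M^T.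
  by apply/matrixP => i j; rewrite !mxE conjE.
pose Ac := map_mx toC A; pose d := spectral_diag Ac; pose P := spectralmx Ac.
have Ah : Ac \is hermsymmx.
  by apply/is_hermitianmxP; rewrite expr0 scale1r trC AT.
have PU : P \is unitarymx := spectral_unitarymx Ac.
have AE : Ac = P^t* *m diag_mx d *m P.
  rewrite -invmx_unitary //.
  by have /hermitian_normalmx /orthomx_spectralP := Ah.
have d_le i : d 0 i <= toC t.
  have d_eigen : eigenvalue Ac (d 0 i).
    apply/eigenvalueP; exists (row i P).
      rewrite AE !mulmxA -row_mul (unitarymxP PU) row1.
      by rewrite -rowE row_diag_mx -scalemxAl -rowE.
    apply/eqP => /(congr1 (fun v => v *m P ^t*)).
    rewrite -row_mul (unitarymxP PU) mul0mx row1 => /matrixP/(_ 0 i)/eqP.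
    by rewrite !mxE !eqxx oner_eq0.
  (* The diagonal entry is real, so it is a root of the characteristic polynomial of [A] over [R]
     itself. *)
  have /mxOverP/(_ 0 i)/RRe_real := hermitian_spectral_diag_real Ah.
  rewrite -/d => dr; move: d_eigen; rewrite -dr lecR => d_eigen; apply: At.
  rewrite eigenvalue_root_char -(fmorph_root (real_complex R)) map_char_poly.
  by rewrite -eigenvalue_root_char.
pose z := map_mx toC x *m P^t*.
have quad (D : 'M[R[i]]_n) : map_mx toC x *m (P^t* *m D *m P) *m map_mx toC x^T
    = z *m D *m z^t*.
  by rewrite /z trmx_mul map_mxM /= trmxCK trC !mulmxA.
have castE (D : 'M[R]_n) : toC ((x *m D *m x^T) 0 0)
    = (map_mx toC x *m map_mx toC D *m map_mx toC x^T) 0 0.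
  by rewrite -!map_mxM /= [RHS]mxE.
(* Inserting the identity makes both sides quadratic forms, diagonal in the coordinates [z]. *)
rewrite -[X in t * (X *m _) 0 0]mulmx1.
suff : toC ((x *m A *m x^T) 0 0) <= toC t * toC ((x *m 1%:M *m x^T) 0 0).
  by rewrite -(rmorphM (real_complex R)) lecR.
rewrite !castE -/Ac AE quad map_mx1.
have -> : 1%:M = P^t* *m 1%:M *m P.
  by rewrite mulmx1 -invmx_unitary // mulVmx // unitarymx_unit.
rewrite quad mulmx1 !mxE mulr_sumr; apply: ler_sum => i _.
by rewrite mul_mx_diag !mxE mulrAC mulrC ler_wpM2r // mul_conjC_ge0.
Qed.
End Gram.

(** * Shannon capacity, matchings and strong powers *)

Lemma shannon_capacity_eq (R : realType) (T : finType) (adj : rel T) (m : nat) :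
  (forall n, independence_number (strong_power adj (n := n)) = m ^ n)%N ->
  shannon_capacity R adj = m%:R.
Proof.
move=> am; rewrite /shannon_capacity.
apply: cvg_lim; [exact: norm_hausdorff|apply: cvg_near_cst].
(* The index [0] is excluded: there the exponent [0^-1] is [0] and the term is [1], whatever [m]
   is. *)
exists 1%N => // n /= n_gt0; rewrite am natrX -powR_mulrn // -powRrM.
by rewrite mulfV ?powRr1 // pnatr_eq0 -lt0n.
Qed.

Section Hypergraph.
Variables (V : finType) (E : {set {set V}}) (k : nat).
Hypothesis k_gt0 : (0 < k)%N.
Hypothesis Ek : k_uniform E k.

Lemma card_edge_set (M : {set {set V}}) :
  M \subset E -> #|[pred f : edge E | val f \in M]| = #|M|.
Proof.
move=> ME; rewrite -(fintype.card_image val_inj); apply: eq_card => f.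
apply/fintype.imageP/idP => [[g gM ->] // | fM].
by exists (Sub f (fintype.subsetP ME _ fM) : edge E); rewrite ?inE.
Qed.

Lemma matchingP (M : {set {set V}}) :
  reflect ({subset M <= E} /\
           {in M &, forall (f g : {set V}) (v : V),
              v \in f -> v \in g -> f = g})
          (matching E M).
Proof.
apply: (iffP andP) => -[ME Mt]; split.
- exact/fintype.subsetP.
- move=> f g fM gM v vf vg; apply/eqP; apply/negPn/negP => fg.
  have /finset.trivIsetP/(_ f g fM gM fg) := Mt.
  by move=> /disjointFr/(_ vf); rewrite vg.
- exact/fintype.subsetP.
- apply/finset.trivIsetP => f g fM gM fg; apply/pred0P => v /=.
  by apply/andP => -[vf vg]; move/eqP: fg; apply; exact: (Mt _ _ fM gM v).
Qed.

Lemma matching_card_le (M : {set {set V}}) :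
  matching E M -> (#|M| <= matching_number E)%N.
Proof.
by move=> ME; exact: (leq_bigmax_cond (F := fun N : {set {set V}} => #|N|)).
Qed.

Lemma matching_number_attained :
  exists2 M, matching E M & #|M| = matching_number E.
Proof.
have [|M M1 M2] := @eq_bigmax_cond _ (matching E) (fun M => #|M|).
  apply/card_gt0P; exists finset.set0; apply/matchingP.
  by split => [f|f g]; rewrite inE.
by exists M.
Qed.

Lemma card_matching_cover (M : {set {set V}}) :
  matching E M -> #|finset.cover M| = (k * #|M|)%N.
Proof.
move=> /andP[/fintype.subsetP ME Mt].
have [_] := leq_card_cover M; rewrite Mt => /eqP ->.
by rewrite mulnC -sum_nat_const; apply: eq_bigr => f /ME /Ek.
Qed.

Lemma independent_power_le n (S : {set {ffun 'I_n -> edge E}}) :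
  independent (strong_power (intersection_graph E) (n := n)) S ->
  (#|S| * k ^ n <= #|V| ^ n)%N.
Proof.
move=> Si; pose box (x : {ffun 'I_n -> edge E}) :=
  family (fun i : 'I_n => mem (val (x i))) : {pred {ffun 'I_n -> V}}.
have card_box x : #|box x| = (k ^ n)%N.
  rewrite card_family foldrE big_map big_enum /=.
  rewrite (eq_bigr (fun=> k)) ?prod_nat_const ?card_ord // => i _.
  exact: Ek (valP (x i)).
(* A common point [v] puts [v i] in both [x i] and [y i], so distinct [x] and [y] would be
   adjacent. *)
have boxI x y v : x \in S -> y \in S -> v \in box x -> v \in box y -> x = y.
  move=> xS yS /familyP vx /familyP vy; apply/eqP/negPn/negP => xy.
  have /forall_inP/(_ x xS)/forall_inP/(_ y yS) := Si.
  rewrite /strong_power xy => /forallP; apply => i.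
  case: eqVneq => //= xyi; rewrite /intersection_graph xyi.
  by apply/finset.set0Pn; exists (v i); rewrite inE vx vy.
rewrite -sum_nat_const -[X in (_ <= _ ^ X)%N]card_ord -card_ffun.
(* Double counting of the pairs of a box and a point in it: each point is counted at most once. *)
under eq_bigr => x _ do rewrite -(card_box x) -sum1_card big_mkcond.
rewrite exchange_big /= -sum1_card; apply: leq_sum => v _.
have [/exists_inP[x xS xv]|] := boolP [exists x in S, v \in box x].
  rewrite (bigD1 x) //= xv big1 // => y /andP[yS yx].
  by case: ifP => // yv; rewrite (boxI _ _ _ yS xS yv xv) eqxx in yx.
by move=> /exists_inPn nx; rewrite big1 // => x /nx /negbTE ->.
Qed.

(** Edges of [M] that meet are equal, so two adjacent tuples over [M] would coincide. *)
Lemma matching_power_le n (M : {set {set V}}) : matching E M ->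
  (#|M| ^ n <=
   independence_number (strong_power (intersection_graph E) (n := n)))%N.
Proof.
move=> ME; have /matchingP[ME1 Mdis] := ME.
pose F : {pred {ffun 'I_n -> edge E}} :=
  ffun_on [pred f : edge E | val f \in M].
have <- : #|[set x in F]%SET| = (#|M| ^ n)%N.
  rewrite cardsE card_ffun_on card_ord card_edge_set //.
  exact/fintype.subsetP.
apply: (leq_bigmax_cond (F := fun S : {set _} => #|S|)).
apply/forall_inP => x; rewrite inE => /ffun_onP xM.
apply/forall_inP => y; rewrite inE => /ffun_onP yM.
apply/negP => /andP[/eqP xy /forallP adj]; apply: xy; apply/ffunP => i.
have /orP[/eqP //|/andP[_ /finset.set0Pn[v]]] := adj i.
rewrite inE => /andP[vx vy]; apply/val_inj.
by apply: (Mdis _ _ (xM i) (yM i) v).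
Qed.

Lemma independence_number_power n (M : {set {set V}}) :
  matching E M -> finset.cover M = [set: V]%SET ->
  independence_number (strong_power (intersection_graph E) (n := n))
    = (#|M| ^ n)%N.
Proof.
move=> ME MV; apply/eqP; rewrite eqn_leq matching_power_le // andbT.
apply/bigmax_leqP => S /independent_power_le.
(* As [#|V| = k * #|M|], the factor [k ^ n] cancels from the box bound. *)
rewrite -cardsT -MV card_matching_cover // expnMn mulnC.
by rewrite leq_pmul2l // expn_gt0 k_gt0.
Qed.

End Hypergraph.

(** * The incidence matrix and the matching bound *)

Section Incidence.
Variables (R : realType) (V : finType) (E : {set {set V}}) (k : nat).
Hypothesis k_gt0 : (0 < k)%N.
Hypothesis Ek : k_uniform E k.

Local Notation B := (incidence_matrix E R).
Local Notation ones := (const_mx 1 : 'cV[R]_#|edge E|).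

Lemma sum_mem_card (T : finType) (A : {pred T}) :
  \sum_(i < #|T|) (enum_val i \in A)%:R = #|A|%:R :> R.
Proof.
rewrite -(big_enum_val (fun i : T => (i \in A)%:R)) -natr_sum -sum1_card.
by congr _%:R; rewrite [RHS]big_mkcond; apply: eq_bigr => i _; case: (i \in A).
Qed.

Definition edge_indicator (M : {set {set V}}) : 'cV[R]_#|edge E| :=
  \col_i (val (enum_val i : edge E) \in M)%:R.

Definition vertex_indicator (A : {set V}) : 'cV[R]_#|V| :=
  \col_i ((enum_val i : V) \in A)%:R.

Lemma trmx_incidence_indicator (A : {set V}) i :
  (B^T *m vertex_indicator A) i 0 = #|val (enum_val i : edge E) :&: A|%:R.
Proof.
rewrite mxE -(sum_mem_card (val (enum_val i : edge E) :&: A)%SET).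
by apply: eq_bigr => u _; rewrite !mxE -natrM mulnb inE.
Qed.

Lemma trmx_incidence_setT : B^T *m vertex_indicator [set: V] = k%:R *: ones.
Proof.
apply/colP => i; rewrite trmx_incidence_indicator finset.setIT !mxE mulr1.
by rewrite (Ek (valP (enum_val i))).
Qed.

Lemma dot_vertex_indicator (A : {set V}) :
  dot (vertex_indicator A) (vertex_indicator A) = #|A|%:R.
Proof.
rewrite dotE -(sum_mem_card A); apply: eq_bigr => i _.
by rewrite !mxE -natrM mulnb andbb.
Qed.

Lemma dot_ones_edge (M : {set {set V}}) :
  M \subset E -> dot ones (edge_indicator M) = #|M|%:R.
Proof.
move=> ME; rewrite dotE -(card_edge_set ME) -sum_mem_card.
by apply: eq_bigr => i _; rewrite !mxE mul1r.
Qed.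

(** Disjointness keeps the entries in [{0, 1}]: a vertex lies in at most one edge of [M]. *)
Lemma incidence_matching (M : {set {set V}}) : matching E M ->
  B *m edge_indicator M = vertex_indicator (finset.cover M).
Proof.
move=> /matchingP[ME Mdis]; apply/colP => u; rewrite !mxE.
set v := enum_val u.
rewrite (eq_bigr (fun i => (((v \in val (enum_val i : edge E))
   && (val (enum_val i : edge E) \in M)))%:R)); last first.
  by move=> i _; rewrite !mxE -natrM mulnb.
rewrite (sum_mem_card [pred f : edge E | (v \in val f) && (val f \in M)]).
congr (_%:R); case: (boolP (v \in _)) => [/bigcupP[f fM vf]|vM].
  apply: (@fintype.eq_card1 _ (Sub f (ME f fM) : edge E)) => g.
  rewrite !inE; apply/andP/eqP => [[vg gM]|->] //.
  by apply: val_inj; apply: (Mdis _ _ gM fM v).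
apply: fintype.eq_card0 => g; apply: contraNF vM => /andP[vg gM].
by apply/bigcupP; exists (val g).
Qed.

Lemma gram_solution : let y := group_inverse (B^T *m B) *m ones in
  B^T *m B *m y = ones /\ group_inverse_sum E R = dot ones y.
Proof.
move=> y; split; last by rewrite /dot mulmxA.
have k0 : k%:R != 0 :> R by rewrite pnatr_eq0 -lt0n.
have -> : y = k%:R^-1 *: (group_inverse (B^T *m B) *m
                 (B^T *m vertex_indicator [set: V])).
  by rewrite trmx_incidence_setT -scalemxAr scalerA mulVf // scale1r.
rewrite -scalemxAr !mulmxA gram_group_inverseK trmx_incidence_setT.
by rewrite scalerA mulVf // scale1r.
Qed.

Lemma matching_defect (M : {set {set V}}) : matching E M ->
  let y := group_inverse (B^T *m B) *m ones in
  let d := k%:R *: (B *m y) - vertex_indicator (finset.cover M) in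
  dot d d = k%:R * (k%:R * group_inverse_sum E R - #|M|%:R).
Proof.
move=> MM y d; have [Ny ->] := gram_solution; rewrite -/y in Ny *.
rewrite dotBB dot_vertex_indicator (card_matching_cover Ek MM) natrM.
(* Since [N y = e], the squared norm expands to [k^2 s - 2 k #|M| + k #|M|], where [s] is
   [group_inverse_sum E R]. *)
have By x : dot (B *m y) (B *m x) = dot ones x.
  by rewrite dotC dot_mulmx mulmxA Ny dotC.
rewrite -(incidence_matching MM) !dotZl dotZr !By dot_ones_edge; first by ring.
by case/andP: MM.
Qed.

Lemma matching_le (M : {set {set V}}) : matching E M ->
  #|M|%:R <= k%:R * group_inverse_sum E R.
Proof.
move=> /matching_defect /= dd; rewrite -subr_ge0.
by rewrite -(pmulr_rge0 _ (_ : 0 < k%:R)) ?ltr0n // -dd dot_ge0.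
Qed.

Lemma matching_eq_perfect (M : {set {set V}}) : no_isolated_vertex E ->
  matching E M -> #|M|%:R = k%:R * group_inverse_sum E R ->
  finset.cover M = [set: V]%SET.
Proof.
move=> Vcov MM Meq; have [Ny _] := gram_solution.
have /= := matching_defect MM; rewrite -Meq subrr mulr0 => /dot_eq0/eqP.
rewrite subr_eq0 => /eqP/(congr1 (mulmx B^T)).
rewrite -scalemxAr !mulmxA -(mulmxA (_ *m B)) Ny => /colP Bw.
apply/eqP; rewrite finset.eqEsubset finset.subsetT.
apply/fintype.subsetP => v _.
(* The entry at [f] says that [f] meets the cover in [k] vertices, hence lies inside it. *)
have [f fE vf] := Vcov v; have := Bw (enum_rank (Sub f fE : edge E)).
rewrite trmx_incidence_indicator enum_rankK /= !mxE mulr1 => /eqP.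
rewrite eqr_nat -(Ek fE) eq_sym => /eqP fM.
have /fintype.subsetP/(_ v vf) : f \subset f :&: finset.cover M.
  by rewrite -(subset_leqif_card (finset.subsetIl _ _)) fM.
by rewrite inE => /andP[].
Qed.

(** The indicator [x] of a perfect matching satisfies [N x = k e], so
    [k e^T y = x^T N y = x^T e]. *)
Lemma perfect_matching_eq (M : {set {set V}}) :
  matching E M -> finset.cover M = [set: V]%SET ->
  k%:R * group_inverse_sum E R = #|M|%:R.
Proof.
move=> MM MV; have [Ny ->] := gram_solution; set y := (_ *m ones) in Ny *.
rewrite -dotZl -trmx_incidence_setT -MV -(incidence_matching MM).
rewrite dotC -dot_mulmx dotC dot_mulmx mulmxA Ny dotC dot_ones_edge //.
by case/andP: MM.
Qed.

(** * The Lovász theta function *)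

(* The coefficient of [B^T B] makes the diagonal, where [B^T B] is [k], equal
   to [1]. *)
Definition theta_witness (m : nat) : 'M[R]_#|edge E| :=
  const_mx 1 + m%:R%:M - (m%:R / k%:R) *: (B^T *m B).

Lemma gramE i j : (B^T *m B) i j =
  #|val (enum_val i : edge E) :&: val (enum_val j : edge E)|%:R.
Proof.
rewrite -trmx_incidence_indicator !mxE.
by apply: eq_bigr => u _; rewrite !mxE.
Qed.

Lemma theta_witnessP m : theta_matrix (intersection_graph E) (theta_witness m).
Proof.
have k0 : k%:R != 0 :> R by rewrite pnatr_eq0 -lt0n.
split=> [|i j].
  rewrite /theta_witness linearB linearD linearZ /= trmx_mul trmxK.
  by rewrite trmx_const tr_scalar_mx.
rewrite /theta_witness; move: (B^T *m B) (gramE i j) => N Nij.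
rewrite !mxE Nij; have [<- _|ij] /= := eqVneq i j.
  by rewrite finset.setIid (Ek (valP (enum_val i))) divfK // mulr1n addrK.
(* Distinct nonadjacent edges are disjoint, so only the all-ones term contributes. *)
rewrite /intersection_graph (inj_eq enum_val_inj) ij negbK => /eqP ->.
by rewrite cards0 mulr0 subr0 mulr0n addr0.
Qed.

Lemma theta_witness_quad m (x : 'cV[R]_#|edge E|) :
  dot x (theta_witness m *m x) = dot ones x ^+ 2 + m%:R * dot x x
    - m%:R / k%:R * dot (B *m x) (B *m x).
Proof.
rewrite /theta_witness mulmxBl mulmxDl mul_scalar_mx -scalemxAl.
by rewrite -mulmxA const_mx1_mul dotBr dotDr !dotZr dot_mulmx (dotC x ones).
Qed.

(** On the indicator of [M], the all-ones term and the Gram term both give [#|M| e] and cancel. *)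
Lemma theta_witness_eigenvector (M : {set {set V}}) :
  matching E M -> finset.cover M = [set: V]%SET ->
  theta_witness #|M| *m edge_indicator M = #|M|%:R *: edge_indicator M.
Proof.
move=> MM MV; have k0 : k%:R != 0 :> R by rewrite pnatr_eq0 -lt0n.
rewrite /theta_witness mulmxBl mulmxDl mul_scalar_mx -scalemxAl -mulmxA.
rewrite incidence_matching // MV trmx_incidence_setT scalerA divfK //.
rewrite const_mx1_mul dot_ones_edge; last by case/andP: MM.
by rewrite addrAC subrr add0r.
Qed.

(** The claim amounts to [s^2 <= (m / k) |q|^2], where [k s] is the inner product of [q] with the
    all-ones vector. *)
Lemma theta_witness_le (M : {set {set V}}) x : (0 < #|M|)%N ->
  matching E M -> finset.cover M = [set: V]%SET ->
  dot x (theta_witness #|M| *m x) <= #|M|%:R * dot x x.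
Proof.
move=> M0 MM MV; rewrite theta_witness_quad.
set s := dot ones x; set q := B *m x; set m := #|M|%:R.
have k0 : k%:R != 0 :> R by rewrite pnatr_eq0 -lt0n.
have m0 : m != 0 by rewrite pnatr_eq0 -lt0n.
(* Cauchy-Schwarz for [q] and the all-ones vector of squared norm [k m] *)
have := dot_ge0 (q - (s / m) *: vertex_indicator [set: V]).
rewrite dotBB dotZl !dotZr dot_vertex_indicator.
rewrite [dot q (vertex_indicator _)]dot_mulmx trmx_incidence_setT dotZr.
rewrite (dotC x) -MV (card_matching_cover Ek MM) natrM -/s -/m => qs.
have mk : 0 <= m / k%:R by rewrite divr_ge0 ?ler0n.
rewrite -subr_ge0; apply: etrans (mulr_ge0 mk qs).
by congr (0 <= _); field; rewrite m0 k0.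
Qed.

Lemma largest_eigenvalue_theta_witness (M : {set {set V}}) : (0 < #|M|)%N ->
  matching E M -> finset.cover M = [set: V]%SET ->
  largest_eigenvalue (theta_witness #|M|) #|M|%:R.
Proof.
move=> M0 MM MV; have [AT _] := theta_witnessP #|M|.
have /andP[ME _] := MM.
split=> [|s /eigenvalueP[v vA v0]].
  (* Eigenvectors are row vectors here, so the symmetry of the witness is used to transpose. *)
  apply/eigenvalueP; exists (edge_indicator M)^T.
    by rewrite -[X in _ *m X]AT -trmx_mul theta_witness_eigenvector // linearZ.
  apply/eqP => /(congr1 trmx); rewrite trmxK trmx0 => x0.
  have := dot_ones_edge ME; rewrite x0 /dot mulmx0 mxE => /esym/eqP.
  by rewrite pnatr_eq0 -leqn0 leqNgt M0.
have vv : 0 < dot v^T v^T.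
  rewrite lt_def dot_ge0 andbT; apply: contra v0 => /eqP/dot_eq0 v0.
  by rewrite -[v]trmxK v0 trmx0.
have := theta_witness_le v^T M0 MM MV.
by rewrite -[X in X *m _]AT -trmx_mul vA linearZ dotZr ler_pM2r.
Qed.

(** Edges of [M] are pairwise nonadjacent, so [A] is all ones on them and the Rayleigh quotient at
    the indicator is [#|M|^2 / #|M|]. *)
Lemma largest_eigenvalue_ge_matching (M : {set {set V}})
    (A : 'M[R]_#|edge E|) (t : R) : (0 < #|M|)%N -> matching E M ->
  theta_matrix (intersection_graph E) A -> largest_eigenvalue A t ->
  #|M|%:R <= t.
Proof.
move=> M0 MM [AT A1] [_ At]; have /andP[ME _] := MM.
have /matchingP[_ Mdis] := MM.
pose x := edge_indicator M.
have xx : dot x x = #|M|%:R.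
  rewrite -(dot_ones_edge ME) !dotE; apply: eq_bigr => i _.
  by rewrite !mxE mul1r -natrM mulnb andbb.
have Ax i : x i 0 * (A *m x) i 0 = ones i 0 * x i 0 * #|M|%:R.
  rewrite [x i 0]mxE [const_mx _ _ _]mxE mul1r.
  case: (boolP (_ \in M)) => iM; last by rewrite !mul0r.
  rewrite !mul1r -(dot_ones_edge ME) dotE mxE; apply: eq_bigr => j _.
  rewrite [const_mx _ _ _]mxE [x j 0]mxE.
  case: (boolP (_ \in M)) => jM; last by rewrite !mulr0.
  rewrite A1 //; case: eqVneq => //= ij; rewrite /intersection_graph.
  apply/negP => /andP[ne /finset.set0Pn[v]]; rewrite inE => /andP[vi vj].
  by move/eqP: ne; apply; apply/val_inj/(Mdis _ _ iM jM v).
have xAx : dot x (A *m x) = #|M|%:R * #|M|%:R.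
  by rewrite dotE (eq_bigr _ (fun i _ => Ax i)) -mulr_suml -dotE dot_ones_edge.
have := rayleigh_le x^T AT At.
rewrite trmxK -mulmxA -/(dot x _) -/(dot x x) xAx xx.
by rewrite ler_pM2r // ltr0n.
Qed.

Lemma lovasz_theta_perfect (M : {set {set V}}) :
  matching E M -> finset.cover M = [set: V]%SET ->
  lovasz_theta R (intersection_graph E) = #|M|%:R.
Proof.
move=> MM MV; rewrite /lovasz_theta /minimum.
have [M0|M0] := posnP #|M|.
  (* Here [V] is empty and, as [k > 0], there are no edges. An empty matrix has no eigenvalue, so
     [minimum] takes its default value [0]. *)
  rewrite M0; apply: xgetPN => t [[A [_ [/eigenvalueP[v _ v0] _]]] _].
  case/eqP: v0; apply/rowP => i.
  have := max_card (mem (val (enum_val i : edge E))).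
  rewrite -cardsT -MV (card_matching_cover Ek MM) M0 muln0.
  by rewrite (Ek (valP (enum_val i))) leqNgt k_gt0.
apply: xget_unique.
  split=> [|t [A [AT At]]]; last exact: largest_eigenvalue_ge_matching AT At.
  exists (theta_witness #|M|); split; first exact: theta_witnessP.
  exact: largest_eigenvalue_theta_witness.
move=> t [[A [AT At]] lbt]; apply/eqP; rewrite eq_le.
rewrite (largest_eigenvalue_ge_matching M0 MM AT At) andbT; apply: lbt.
exists (theta_witness #|M|); split; first exact: theta_witnessP.
exact: largest_eigenvalue_theta_witness.
Qed.

End Incidence.

(** For [k = 0] the bound fails: if [V] is empty and the empty set is the only edge, the matching
    number is [1]. *)
Theorem theorem4p8 (R : realType) (V : finType) (E : {set {set V}}) (k : nat) :
  (0 < k)%N -> k_uniform E k -> no_isolated_vertex E ->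
  [/\ (matching_number E)%:R <= k%:R * group_inverse_sum E R,
      (matching_number E)%:R = k%:R * group_inverse_sum E R <->
        has_perfect_matching E
    & has_perfect_matching E ->
      [/\ (matching_number E)%:R = shannon_capacity R (intersection_graph E),
          shannon_capacity R (intersection_graph E)
            = lovasz_theta R (intersection_graph E)
        & lovasz_theta R (intersection_graph E)
            = k%:R * group_inverse_sum E R]].
Proof.
move=> k_gt0 Ek Vcov; have [M MM Mmax] := matching_number_attained E.
(* A perfect matching is maximum, since its size equals the upper bound for all matchings. *)
have perfect N : matching E N -> finset.cover N = [set: V]%SET ->
    k%:R * group_inverse_sum E R = #|N|%:R /\ #|N| = matching_number E.
  move=> MN NV; have gN := perfect_matching_eq R k_gt0 Ek MN NV; split=> //.
  apply/eqP; rewrite eqn_leq matching_card_le //= -Mmax -(ler_nat R) -gN.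
  exact: matching_le.
split.
- by rewrite -Mmax; exact: matching_le.
- split=> [Meq|[N MN NV]]; last by have [-> <-] := perfect N MN NV.
  exists M => //; apply: (matching_eq_perfect (R := R) k_gt0 Ek) => //.
  by rewrite Mmax.
- case=> N MN NV; have [gN Nmax] := perfect N MN NV.
  rewrite gN (lovasz_theta_perfect R k_gt0 Ek MN NV) -Nmax; split=> //.
    apply/esym/shannon_capacity_eq => n.
    exact: (independence_number_power k_gt0 Ek).
  apply: shannon_capacity_eq => n.
  exact: (independence_number_power k_gt0 Ek).
Qed.
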